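(* Let $A=\sigma(R)\langle x_1,\dots,x_n\rangle$ be a skew PBW extension over a ring $R$, with associated system $(\Sigma,\Delta)$ of endomorphisms and $\Sigma$-derivations of $R$, and suppose that $R$ is $\Sigma$-semicommutative and Baer. Then the following statements hold: (1) $R$ is $\Sigma$-rigid. (2) $A$ is reduced, and therefore $A$ is Abelian. (3) $R$ is $\Sigma$-skew Armendariz. (4) $R$ is $(\Sigma,\Delta)$-compatible. (5) $R$ is weak symmetric if and only if $A$ is weak symmetric. (6) Both $R$ and $A$ are reflexive. (7) $R$ is $\Sigma$-skew RNP.
   Context: Rings are associative with identity; $\mathbb{N}$ includes $0$; $N(B)$ is the set of nilpotent elements of a ring $B$. Skew PBW extension: $A=\sigma(R)\langle x_1,\dots,x_n\rangle$ is a skew PBW extension over $R$ if (i) $R$ is a subring of $A$ with the same identity; (ii) there are $x_1,\dots,x_n\in A$ such that $A$ is a free left $R$-module with basis $\mathrm{Mon}(A):=\{x^\alpha:=x_1^{\alpha_1}\cdots x_n^{\alpha_n}\mid \alpha=(\alpha_1,\dots,\alpha_n)\in\mathbb{N}^n\}$; (iii) for each $i$ and each $r\in R\setminus\{0\}$ there is $c_{i,r}\in R\setminus\{0\}$ with $x_ir-c_{i,r}x_i\in R$; (iv) for all $1\le i,j\le n$ there is $d_{i,j}\in R\setminus\{0\}$ with $x_jx_i-d_{i,j}x_ix_j\in R+Rx_1+\cdots+Rx_n$. For such $A$, for each $i$ there are an injective ring endomorphism $\sigma_i$ of $R$ and a $\sigma_i$-derivation $\delta_i$ of $R$ (an additive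 map with $\delta_i(rs)=\sigma_i(r)\delta_i(s)+\delta_i(r)s$) such that $x_ir=\sigma_i(r)x_i+\delta_i(r)$ for all $r\in R$. Put $\Sigma:=\{\sigma_1,\dots,\sigma_n\}$, $\Delta:=\{\delta_1,\dots,\delta_n\}$, and for $\alpha\in\mathbb{N}^n$, $\sigma^\alpha:=\sigma_1^{\alpha_1}\circ\cdots\circ\sigma_n^{\alpha_n}$, $\delta^\alpha:=\delta_1^{\alpha_1}\circ\cdots\circ\delta_n^{\alpha_n}$. $R$ is $\Sigma$-semicommutative if for all $a,b\in R$, $ab=0$ implies $aR\sigma^\alpha(b)=0$ for every $\alpha\in\mathbb{N}^n\setminus\{0\}$. $R$ is $\Sigma$-rigid if for all $a\in R$ and $\alpha\in\mathbb{N}^n$, $a\sigma^\alpha(a)=0$ implies $a=0$. $R$ is $(\Sigma,\Delta)$-compatible if for all $a,b\in R$ and $\alpha,\beta\in\mathbb{N}^n$: $a\sigma^\alpha(b)=0$ if and only if $ab=0$; and $ab=0$ implies $a\delta^\beta(b)=0$. $R$ is $\Sigma$-skew Armendariz if for all $f=\sum_{i=0}^m a_iX_i$ and $g=\sum_{j=0}^t b_jY_j$ in $A$ (coefficients in $R$; the $X_i$ pairwise distinct in $\mathrm{Mon}(A)$, likewise the $Y_j$), $fg=0$ implies $a_i\sigma^{\alpha_i}(b_j)=0$ for all $i,j$, where $\alpha_i=\exp(X_i)\in\mathbb{N}^n$ is the exponent with $X_i=x^{\alpha_i}$. $R$ is $\Sigma$-skew RNP if for all $a,b\in N(R)$, $aRb=0$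 implies both $bR\sigma^\alpha(a)=0$ and $\sigma^\alpha(b)Ra=0$ for every $\alpha\in\mathbb{N}^n$. A ring $B$ is: Baer if the right (equivalently, left) annihilator of every nonempty subset is generated, as a right (respectively left) ideal, by an idempotent; reduced if it has no nonzero nilpotent elements; Abelian if all its idempotents are central; weak symmetric if for all $a,b,c\in B$, $abc\in N(B)$ implies $acb\in N(B)$; reflexive if for all $a,b\in B$, $aBb=0$ implies $bBa=0$. *)

(* Defs.v *)
From HB Require Import structures.
From mathcomp Require Import all_boot all_order all_algebra.

Set Implicit Arguments.
Unset Strict Implicit.
Unset Printing Implicit Defensive.

Import GRing.Theory.
Local Open Scope ring_scope.

Section RingNotions.
Variable B : pzRingType.

Definition nilpotent_elt (a : B) : Prop := exists k : nat, a ^+ k = 0.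

Definition idempotent_elt (e : B) : Prop := e * e = e.

Definition in_right_annihilator (S : B -> Prop) (r : B) : Prop :=
  forall s, S s -> s * r = 0.

Definition Baer : Prop :=
  forall S : B -> Prop, (exists s, S s) ->
  exists2 e, idempotent_elt e &
    forall r, in_right_annihilator S r <-> exists t, r = e * t.

Definition reduced : Prop := forall a : B, nilpotent_elt a -> a = 0.

Definition Abelian_ring : Prop :=
  forall e : B, idempotent_elt e -> forall r, e * r = r * e.

Definition weak_symmetric : Prop :=
  forall a b c : B, nilpotent_elt (a * b * c) -> nilpotent_elt (a * c * b).

Definition reflexive_ring : Prop :=
  forall a b : B, (forall r, a * r * b = 0) -> forall r, b * r * a = 0.

End RingNotions.

Notation exponent n := {ffun 'I_n -> nat}.

(* Products and compositions over 'I_n are taken in increasing order of the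
   index, so the noncommutative expressions below read x_1^a_1 ... x_n^a_n and
   phi_1^a_1 \o ... \o phi_n^a_n. *)
Definition mon (A : pzRingType) n (x : 'I_n -> A) (alpha : exponent n) : A :=
  \prod_(i < n) x i ^+ alpha i.

Definition comp_pow (T : Type) n (phi : 'I_n -> T -> T) (alpha : exponent n) :
    T -> T :=
  \big[@comp T T T/id]_(i < n) iter (alpha i) (phi i).

Section SkewPBW.
Variables (R A : pzRingType) (n : nat).

(* The inclusion of the subring R in A is the injective unital ring morphism
   iota, which also gives A its left R-module structure. *)
Record skew_PBW_extension (iota : {rmorphism R -> A}) (x : 'I_n -> A) : Prop :=
  SkewPBWExtension {
    pbw_subring : injective iota;
    pbw_span : forall f : A, exists (s : seq (exponent n)) (c : exponent n -> R),
      f = \sum_(alpha <- s) iota (c alpha) * mon x alpha;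
    pbw_free : forall (s : seq (exponent n)) (c : exponent n -> R), uniq s ->
      \sum_(alpha <- s) iota (c alpha) * mon x alpha = 0 ->
      forall alpha, alpha \in s -> c alpha = 0;
    pbw_coef : forall (i : 'I_n) (r : R), r != 0 ->
      exists2 c : R, c != 0 &
        exists s : R, x i * iota r - iota c * x i = iota s;
    pbw_var : forall i j : 'I_n,
      exists2 d : R, d != 0 &
        exists (s : R) (t : 'I_n -> R),
          x j * x i - iota d * x i * x j = iota s + \sum_(k < n) iota (t k) * x k
  }.

Variables (sigma : 'I_n -> {rmorphism R -> R})
          (delta : 'I_n -> {additive R -> R}).

(* For a skew PBW extension such a system exists and is unique. *)
Record associated_system (iota : {rmorphism R -> A}) (x : 'I_n -> A) : Prop :=
  AssociatedSystem {
    assoc_inj : forall i, injective (sigma i);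
    assoc_derivation : forall i (r s : R),
      delta i (r * s) = sigma i r * delta i s + delta i r * s;
    assoc_comm : forall i (r : R),
      x i * iota r = iota (sigma i r) * x i + iota (delta i r)
  }.

Definition sigma_pow : exponent n -> R -> R := comp_pow (fun i => sigma i).
Definition delta_pow : exponent n -> R -> R := comp_pow (fun i => delta i).

Definition Sigma_semicommutative : Prop :=
  forall a b : R, a * b = 0 ->
  forall alpha : exponent n, alpha != [ffun=> 0%N] ->
  forall r, a * r * sigma_pow alpha b = 0.

Definition Sigma_rigid : Prop :=
  forall (a : R) (alpha : exponent n), a * sigma_pow alpha a = 0 -> a = 0.

Definition Sigma_Delta_compatible : Prop :=
  forall (a b : R) (alpha beta : exponent n),
    (a * sigma_pow alpha b = 0 <-> a * b = 0) /\
    (a * b = 0 -> a * delta_pow beta b = 0).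

(* The monomials X_i and Y_j are given by their exponents u i and v j; in a
   skew PBW extension distinct exponents give distinct monomials. *)
Definition Sigma_skew_Armendariz
    (iota : {rmorphism R -> A}) (x : 'I_n -> A) : Prop :=
  forall (m t : nat) (a : 'I_m.+1 -> R) (u : 'I_m.+1 -> exponent n)
         (b : 'I_t.+1 -> R) (v : 'I_t.+1 -> exponent n),
    injective u -> injective v ->
    (\sum_(i < m.+1) iota (a i) * mon x (u i)) *
    (\sum_(j < t.+1) iota (b j) * mon x (v j)) = 0 ->
    forall i j, a i * sigma_pow (u i) (b j) = 0.

Definition Sigma_skew_RNP : Prop :=
  forall a b : R, nilpotent_elt a -> nilpotent_elt b ->
  (forall r, a * r * b = 0) ->
  forall alpha : exponent n,
    (forall r, b * r * sigma_pow alpha a = 0) /\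
    (forall r, sigma_pow alpha b * r * a = 0).

End SkewPBW.

(* Main.v *)
Require Import Defs.
From HB Require Import structures.
From mathcomp Require Import all_boot all_order all_algebra.
From mathcomp Require Import mpoly.

Set Implicit Arguments.
Unset Strict Implicit.
Unset Printing Implicit Defensive.

Import GRing.Theory.
Local Open Scope ring_scope.

(** Everything rests on idempotents.  If e is one, Sigma-semicommutativity
    applied to e (1 - e) = 0 and (1 - e) e = 0 forces sigma^alpha (e) = e, hence
    e is central, hence every delta_i kills e, hence e commutes with all the
    x_i and is central in A.  In a Baer ring the right annihilator of a is eR
    with e such an idempotent, so a b = 0 amounts to b = e b, where a e = 0
    ([annihilator_idempotent]).  Since sigma^alpha and delta^beta are e-linear,
    they can be moved through this equation: that gives reducedness, rigidity
    and compatibility of R.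

    In A, a monomial x^alpha multiplies as
      x^alpha (r x^beta) = sigma^alpha (r) u x^(alpha + beta) + lower degree,
    with u right invertible ([mon_mul_term]).  So, for the degree-lexicographic
    order, f g = 0 forces a sigma^alpha (b) = 0, then a b = 0, for the leading
    coefficients a and b ([leading_mul0]).  Taking e with r(a) = eR, f kills
    (1 - e) g, which has lost the leading term of g; by induction a kills every
    coefficient of g ([leading_coef_annihilates]).  As the idempotents of R are
    central in A, the leading term of f then kills g, and induction on f shows
    that all coefficients of f kill all those of g
    ([coefficients_annihilate]).  This is the Armendariz property, and with
    f = g it shows that A is reduced because R is.

    The other claims are facts on reduced rings: these are Abelian, reflexive
    and weak symmetric, and the RNP condition only concerns nilpotents. *)

(** * Reduced rings *)

Lemma sqr_free_reduced (B : pzRingType) :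
  (forall a : B, a * a = 0 -> a = 0) -> reduced B.
Proof.
move=> sqr0 a [k]; elim: k => [|[|k] IHk].
  by rewrite expr0 -[a]mulr1 => ->; rewrite mulr0.
  by rewrite expr1.
move=> ak0; apply/IHk/sqr0; rewrite -exprD.
by rewrite addnS -addSn exprD ak0 mul0r.
Qed.

Section ReducedRing.
Variable B : pzRingType.
Hypothesis redB : reduced B.
Implicit Types a b c r : B.

Lemma reduced_sqr0 a : a * a = 0 -> a = 0.
Proof. by move=> aa0; apply: redB; exists 2%N; rewrite expr2. Qed.

Lemma reduced_mulC0 a b : a * b = 0 -> b * a = 0.
Proof.
by move=> ab0; apply: reduced_sqr0; rewrite -mulrA (mulrA a) ab0 mul0r mulr0.
Qed.

(** A reduced ring is semicommutative: with b a = 0, the square of a r b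
    contains the factor b a. *)
Lemma reduced_insert a b r : a * b = 0 -> a * r * b = 0.
Proof.
move=> ab0; apply: reduced_sqr0.
by rewrite -!mulrA (mulrA b) (reduced_mulC0 ab0) mul0r !mulr0.
Qed.

(** Semicommutativity inserts c between a and b c, then a between a c b and c,
    which kills the square of a c b. *)
Lemma reduced_symmetric a b c : a * b * c = 0 -> a * c * b = 0.
Proof.
move=> abc0; have acbc0 : a * c * b * c = 0.
  rewrite -mulrA; apply: reduced_insert.
  by rewrite mulrA.
apply: reduced_sqr0; rewrite mulrA.
suff -> : a * c * b * (a * c) = 0 by rewrite mul0r.
by rewrite mulrA; apply: reduced_insert.
Qed.

Lemma reduced_Abelian : Abelian_ring B.
Proof.
move=> e ee r.
have e1 : e * (1 - e) = 0 by rewrite mulrBr mulr1 ee subrr.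
have := reduced_insert r e1; rewrite mulrBr mulr1 => /eqP.
have := reduced_insert r (reduced_mulC0 e1).
rewrite mulrBl mul1r mulrBl => /eqP; rewrite !subr_eq0 => /eqP -> /eqP.
by [].
Qed.

Lemma reduced_reflexive : reflexive_ring B.
Proof.
move=> a b aBb0 r; apply/reduced_insert/reduced_mulC0.
by rewrite -[a]mulr1.
Qed.

Lemma reduced_weak_symmetric : weak_symmetric B.
Proof.
by move=> a b c /redB abc0; exists 1%N; rewrite expr1 reduced_symmetric.
Qed.

End ReducedRing.

(** * Exponents and compositions of powers *)

(** All factors before j being neutral, the new factor y meets nothing on its
    way to the left of the ordered product.  The operation is merely associative
    so as to cover both the product of A and the composition of maps. *)
Lemma big_update_head (T : Type) (idx : T) (op : T -> T -> T)
    (opA : associative op) (op1 : left_id idx op) n (f g : 'I_n -> T) (j : 'I_n) y :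
  (forall k : 'I_n, (k < j)%N -> f k = idx) ->
  (forall k, k != j -> g k = f k) -> g j = op y (f j) ->
  \big[op/idx]_k g k = op y (\big[op/idx]_k f k).
Proof.
elim: n f g j => [|n IHn] f g j fj gf gj; first by case: j {fj gf gj}.
rewrite !big_ord_recl; case: (unliftP ord0 j) => [j'|] def_j.
  rewrite gf ?def_j// fj ?def_j// !op1; apply: (IHn _ _ j') => [k lt_kj|k neq_kj|].
  - by apply: fj; rewrite def_j !lift0 ltnS.
  - by rewrite gf// def_j (inj_eq lift_inj).
  - by rewrite -def_j.
rewrite -def_j gj -opA; congr (op _ (op _ _)); apply: eq_bigr => k _.
by rewrite gf// def_j eq_sym neq_lift.
Qed.

Section Exponents.
Variable n : nat.
Implicit Types (alpha beta gamma : exponent n) (i j k : 'I_n).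

Definition unit_exp j : exponent n := [ffun k => (k == j : nat)].

Definition degree alpha : nat := \sum_i alpha i.

Definition supported_from j alpha := forall k, (k < j)%N -> alpha k = 0%N.

Lemma expD alpha beta i : (alpha + beta) i = (alpha i + beta i)%N.
Proof. by rewrite ffunE. Qed.

Lemma exp0 i : (0 : exponent n) i = 0%N.
Proof. by rewrite ffunE. Qed.

Lemma degreeD alpha beta : degree (alpha + beta) = (degree alpha + degree beta)%N.
Proof. by rewrite -big_split; apply: eq_bigr => i _; rewrite expD. Qed.

Lemma degree_unit j : degree (unit_exp j) = 1%N.
Proof.
rewrite /degree (bigD1 j)//= ffunE eqxx big1// => k neq_kj.
by rewrite ffunE (negPf neq_kj).
Qed.

Lemma supported_from_add j i gamma :
  (j <= i)%N -> supported_from j gamma -> supported_from j (gamma + unit_exp i).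
Proof.
move=> le_ji gamma_j k lt_kj; rewrite expD gamma_j// ffunE.
by case: eqVneq => // eq_ki; rewrite -eq_ki leqNgt lt_kj in le_ji.
Qed.

(** Exponents are built by always adding a unit vector at or before the head
    of the support; this matches the order of the factors in x^gamma and in
    sigma^gamma, where the new factor then simply appears on the left. *)
Lemma exponent_ind (P : exponent n -> Prop) :
  P 0 ->
  (forall j gamma, supported_from j gamma -> P gamma -> P (gamma + unit_exp j)) ->
  forall gamma, P gamma.
Proof.
move=> P0 PS gamma; have [d] := ubnP (degree gamma).
elim: d gamma => // d IHd gamma le_d.
have [/existsP [j0 nz_j0]|/existsPn gamma0] :=
    boolP [exists j, gamma j != 0%N]; last first.
  suff -> : gamma = 0 by [].
  by apply/ffunP => j; rewrite ffunE; apply/eqP; have := gamma0 j; rewrite negbK.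
(* j is the first index of the support of gamma. *)
case: (@arg_minnP _ j0 (fun k => gamma k != 0%N) val nz_j0) => j nz_j min_j.
pose gamma' : exponent n := [ffun k => (gamma k - (k == j))%N].
have def_gamma : gamma = gamma' + unit_exp j.
  apply/ffunP => k; rewrite expD !ffunE subnK//.
  by case: eqVneq => // ->; rewrite lt0n.
rewrite def_gamma; apply: PS; last first.
  by apply: IHd; move: le_d; rewrite def_gamma degreeD degree_unit addn1 ltnS.
move=> k lt_kj; rewrite ffunE; apply/eqP; apply: contraLR lt_kj => nz_k.
by rewrite -leqNgt min_j//; apply: contraNneq nz_k => ->.
Qed.

Lemma comp_pow0 (T : Type) (phi : 'I_n -> T -> T) : comp_pow phi 0 = id.
Proof.
rewrite /comp_pow; apply: (big_ind (fun f => f = id)) => //.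
  by move=> f g -> ->.
by move=> i _; rewrite ffunE.
Qed.

Lemma comp_powS (T : Type) (phi : 'I_n -> T -> T) j gamma :
  supported_from j gamma ->
  comp_pow phi (gamma + unit_exp j) = phi j \o comp_pow phi gamma.
Proof.
move=> gamma_j; apply: (@big_update_head _ id (@comp T T T) _ _ _ _ _ j) => //.
- by move=> k lt_kj; rewrite gamma_j.
- by move=> k neq_kj; rewrite expD ffunE (negPf neq_kj) addn0.
- by rewrite expD ffunE eqxx addn1.
Qed.

Lemma comp_pow_unit (T : Type) (phi : 'I_n -> T -> T) j :
  comp_pow phi (unit_exp j) = phi j.
Proof.
rewrite -[unit_exp j]add0r comp_powS ?comp_pow0// => k _.
exact: exp0.
Qed.

Lemma comp_pow_rel (T : Type) (phi : 'I_n -> T -> T) (P : (T -> T) -> Prop) :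
  P id -> (forall i f, P f -> P (phi i \o f)) -> forall gamma, P (comp_pow phi gamma).
Proof.
move=> Pid PS; elim/exponent_ind => [|j gamma gamma_j]; first by rewrite comp_pow0.
by rewrite comp_powS//; apply: PS.
Qed.

Lemma mon0 (A : pzRingType) (x : 'I_n -> A) : mon x 0 = 1.
Proof. by rewrite /mon big1// => i _; rewrite ffunE. Qed.

Lemma monS (A : pzRingType) (x : 'I_n -> A) j gamma :
  supported_from j gamma -> mon x (gamma + unit_exp j) = x j * mon x gamma.
Proof.
move=> gamma_j; apply: (@big_update_head _ _ _ (@mulrA A) (@mul1r A) _ _ _ j).
- by move=> k lt_kj; rewrite gamma_j.
- by move=> k neq_kj; rewrite expD ffunE (negPf neq_kj) addn0.
- by rewrite expD ffunE eqxx addn1 exprS.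
Qed.

Lemma mon_unit (A : pzRingType) (x : 'I_n -> A) j : mon x (unit_exp j) = x j.
Proof.
rewrite -[unit_exp j]add0r monS ?mon0 ?mulr1// => k _.
exact: exp0.
Qed.

(** ** Degree-lexicographic order *)

(** The monomial order of multivariate polynomials is reused here: it is total,
    refines the degree and is compatible with addition. *)
Definition multi alpha : 'X_{1..n} := [multinom alpha i | i < n].

Definition deglex_lt alpha beta : bool := (multi alpha < multi beta)%O.

Lemma multi_inj : injective multi.
Proof. by move=> a b /mnmP eq_ab; apply/ffunP=> i; have := eq_ab i; rewrite !mnmE. Qed.

Lemma multiD alpha beta : multi (alpha + beta) = (multi alpha + multi beta)%MM.
Proof. by apply/mnmP => i; rewrite mnmDE !mnmE expD. Qed.

Lemma degree_multi alpha : mdeg (multi alpha) = degree alpha.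
Proof. by rewrite mdegE; apply: eq_bigr => i _; rewrite mnmE. Qed.

Lemma deglex_irr : irreflexive deglex_lt.
Proof. by move=> a; rewrite /deglex_lt Order.POrderTheory.ltxx. Qed.

Lemma deglex_trans : transitive deglex_lt.
Proof. by move=> b a c; apply: Order.POrderTheory.lt_trans. Qed.

Lemma deglex_degree alpha beta : (degree alpha < degree beta)%N -> deglex_lt alpha beta.
Proof. by rewrite -!degree_multi; apply: lt_mdeg_ltmc. Qed.

Lemma deglex_addl alpha alpha' beta :
  deglex_lt alpha' alpha -> deglex_lt (alpha' + beta) (alpha + beta).
Proof. by rewrite /deglex_lt !multiD ltmc_add2l. Qed.

Lemma deglex_addr alpha beta beta' :
  deglex_lt beta' beta -> deglex_lt (alpha + beta') (alpha + beta).
Proof. by rewrite /deglex_lt !multiD ltmc_add2r. Qed.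

(** The head of the sorted list carries the leading term, which is the one that
    the inductions on the number of terms remove. *)
Lemma deglex_sort (I : eqType) (u : I -> exponent n) (s : seq I) :
  uniq (map u s) ->
  exists2 s', perm_eq s s' & sorted (fun i j : I => deglex_lt (u j) (u i)) s'.
Proof.
move=> uniq_us.
pose le (i j : I) := (multi (u j) <= multi (u i))%O.
exists (sort le s); first by rewrite perm_sym perm_sort.
have : sorted le (sort le s).
  by apply: sort_sorted => i j; apply: Order.TotalTheory.le_total.
have : uniq (map u (sort le s)).
  by rewrite (perm_uniq (perm_map u (permEl (perm_sort le s)))).
case: (sort le s) => //= i t; elim: t i => //= j t IHt i /andP[ui uj] /andP[le_ij path_j].
rewrite IHt// andbT /deglex_lt Order.POrderTheory.lt_neqAle [X in _ && X]le_ij andbT.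
by apply: contraNneq ui => /multi_inj ->; rewrite mem_head.
Qed.

End Exponents.

(** * Idempotents and annihilators in the coefficient ring *)

Section CoefficientRing.
Variables (R : pzRingType) (n : nat).
Variables (sigma : 'I_n -> {rmorphism R -> R}) (delta : 'I_n -> {additive R -> R}).
Implicit Types (alpha : exponent n) (a b e r : R).

Lemma sigma_powB alpha a b :
  sigma_pow sigma alpha (a - b) = sigma_pow sigma alpha a - sigma_pow sigma alpha b.
Proof.
apply: (comp_pow_rel (P := fun f => f (a - b) = f a - f b)) => // i f /= ->.
by rewrite rmorphB.
Qed.

Lemma sigma_pow1 alpha : sigma_pow sigma alpha 1 = 1.
Proof.
by apply: (comp_pow_rel (P := fun f => f 1 = 1)) => // i f /= ->; rewrite rmorph1.
Qed.

Lemma sigma_pow0 alpha : sigma_pow sigma alpha 0 = 0.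
Proof.
by apply: (comp_pow_rel (P := fun f => f 0 = 0)) => // i f /= ->; rewrite rmorph0.
Qed.

Lemma sigma_powM alpha a b :
  sigma_pow sigma alpha (a * b) = sigma_pow sigma alpha a * sigma_pow sigma alpha b.
Proof.
apply: (comp_pow_rel (P := fun f => f (a * b) = f a * f b)) => // i f /= ->.
by rewrite rmorphM.
Qed.

Hypothesis sigma_inj : forall i, injective (sigma i).

Lemma sigma_pow_inj alpha : injective (sigma_pow sigma alpha).
Proof.
apply: (comp_pow_rel (P := fun f => injective f)) => // i f f_inj.
exact: inj_comp.
Qed.

Hypothesis n_gt0 : (0 < n)%N.
Hypothesis semiR : Sigma_semicommutative sigma.

Lemma idempotent_mul_compl e : idempotent_elt e -> e * (1 - e) = 0 /\ (1 - e) * e = 0.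
Proof. by move=> ee; rewrite mulrBr mulrBl mulr1 mul1r ee subrr. Qed.

(** For alpha nonzero and f = sigma^alpha (e), semicommutativity turns e (1 - e) = 0 and
    (1 - e) e = 0 into e (1 - f) = 0 and (1 - e) f = 0, so e = e f = f. *)
Lemma idempotent_sigma_pow e alpha : idempotent_elt e -> sigma_pow sigma alpha e = e.
Proof.
move=> ee; have [->|nz_alpha] := eqVneq alpha [ffun=> 0%N].
  by rewrite /sigma_pow (comp_pow0 (fun i => sigma i)).
have [e1 e2] := idempotent_mul_compl ee.
have := semiR e1 nz_alpha 1; have := semiR e2 nz_alpha 1.
rewrite !mulr1 sigma_powB sigma_pow1 mulrBr mulrBl mulr1 mul1r => /eqP.
by rewrite subr_eq0 => /eqP <- /eqP; rewrite subr_eq0 eq_sym => /eqP.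
Qed.

Lemma idempotent_sigma e i : idempotent_elt e -> sigma i e = e.
Proof.
move=> /(idempotent_sigma_pow (unit_exp i)).
by rewrite /sigma_pow (comp_pow_unit (fun i => sigma i)).
Qed.

(** Any nonzero alpha gives e r (1 - e) = 0 and (1 - e) r e = 0, as
    sigma^alpha fixes idempotents; positivity of n provides such an alpha. *)
Lemma idempotent_central : Abelian_ring R.
Proof.
move=> e ee r; have [e1 e2] := idempotent_mul_compl ee.
have nz1 : [ffun=> 1%N] != [ffun=> 0%N] :> exponent n.
  by apply/eqP => /ffunP/(_ (Ordinal n_gt0)); rewrite !ffunE.
have := semiR e1 nz1 r; have := semiR e2 nz1 r.
rewrite sigma_powB sigma_pow1 !idempotent_sigma_pow// mulrBl mul1r mulrBr mulr1 mulrBl.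
by move=> /eqP; rewrite subr_eq0 => /eqP -> /eqP; rewrite subr_eq0 => /eqP.
Qed.

Hypothesis delta_deriv : forall i r s,
  delta i (r * s) = sigma i r * delta i s + delta i r * s.

(** Deriving e = e e gives delta e = e delta e + e delta e; multiplying by e
    yields e delta e = 0, hence delta e = 0. *)
Lemma idempotent_delta e i : idempotent_elt e -> delta i e = 0.
Proof.
move=> ee; have := delta_deriv i e e.
rewrite ee idempotent_sigma// -(idempotent_central ee) => de.
have ede0 : e * delta i e = 0.
  have := congr1 (fun z => e * z) de.
  rewrite mulrDr !mulrA ee => /eqP; rewrite -{1}[e * _]addr0 => /eqP.
  by move/addrI.
by rewrite de ede0 addr0.
Qed.

Lemma delta_pow_idempotent e beta r :
  idempotent_elt e -> delta_pow delta beta (e * r) = e * delta_pow delta beta r.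
Proof.
move=> ee; apply: (comp_pow_rel (P := fun f => f (e * r) = e * f r)) => // i f /= ->.
by rewrite delta_deriv (idempotent_sigma _ ee) (idempotent_delta _ ee) mul0r addr0.
Qed.

Hypothesis baerR : Baer R.

(** The Baer property for a single element, in the form used everywhere below:
    annihilation on the right of a is absorption by an idempotent. *)
Lemma annihilator_idempotent a : exists e,
  [/\ idempotent_elt e, a * e = 0 & forall b, a * b = 0 -> b = e * b].
Proof.
have [|e ee anne] := baerR (S := fun s => s = a); first by exists a.
exists e; split=> //.
  by have /(_ a erefl) := (anne e).2 (ex_intro _ 1 (esym (mulr1 e))).
move=> b ab0; have [|t ->] := (anne b).1; first by move=> _ ->.
by rewrite mulrA ee.
Qed.

(** If a a = 0 then a = e a = a e = 0, e being central. *)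
Lemma coefficient_reduced : reduced R.
Proof.
apply: sqr_free_reduced => a aa0.
have [e [ee ae0 /(_ _ aa0) ->]] := annihilator_idempotent a.
by rewrite (idempotent_central ee).
Qed.

(** Both sides say that e absorbs b: as sigma^alpha is injective and fixes e,
    it preserves and reflects the equation b = e b. *)
Lemma mul_sigma_pow0 a b alpha : a * sigma_pow sigma alpha b = 0 <-> a * b = 0.
Proof.
have [e [ee ae0 anne]] := annihilator_idempotent a.
split=> [/anne|/anne ->].
  rewrite -[X in X * _](idempotent_sigma_pow alpha ee) -sigma_powM => /sigma_pow_inj ->.
  by rewrite mulrA ae0 mul0r.
by rewrite sigma_powM idempotent_sigma_pow// mulrA ae0 mul0r.
Qed.

Lemma coefficient_rigid : Sigma_rigid sigma.
Proof.
by move=> a alpha /mul_sigma_pow0; apply: reduced_sqr0; apply: coefficient_reduced.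
Qed.

Lemma coefficient_compatible : Sigma_Delta_compatible sigma delta.
Proof.
move=> a b alpha beta; split; first exact: mul_sigma_pow0.
have [e [ee ae0 anne]] := annihilator_idempotent a => /anne ->.
by rewrite delta_pow_idempotent// mulrA ae0 mul0r.
Qed.

End CoefficientRing.

(** * Monomial calculus in a skew PBW extension *)

Section SkewPBWCalculus.
Variables (R A : pzRingType) (n : nat) (iota : {rmorphism R -> A}) (x : 'I_n -> A).
Implicit Types (alpha beta gamma : exponent n) (P Q : pred (exponent n)).
Implicit Types (r u : R) (f g h : A) (i j : 'I_n).

(** Terms may repeat an exponent here, which makes closure under addition a
    concatenation; [collect_monomials] restores distinct exponents. *)
Definition mon_span P f :=
  exists2 s : seq (exponent n * R), all (fun p => P p.1) s &
    f = \sum_(p <- s) iota p.2 * mon x p.1.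

Lemma mon_span0 P : mon_span P 0.
Proof. by exists [::]; rewrite ?big_nil. Qed.

Lemma mon_spanD P f g : mon_span P f -> mon_span P g -> mon_span P (f + g).
Proof.
move=> [s Ps ->] [t Pt ->]; exists (s ++ t); last by rewrite big_cat.
by rewrite all_cat Ps.
Qed.

Lemma mon_span_mon P r gamma : P gamma -> mon_span P (iota r * mon x gamma).
Proof. by move=> Pg; exists [:: (gamma, r)]; rewrite ?big_seq1//= Pg. Qed.

Lemma mon_span_ind P (S : A -> Prop) :
  S 0 -> (forall f g, S f -> S g -> S (f + g)) ->
  (forall r gamma, P gamma -> S (iota r * mon x gamma)) ->
  forall f, mon_span P f -> S f.
Proof.
move=> S0 SD Smon f [s + ->]; elim: s => [|[gamma r] s IHs] /=.
  by rewrite big_nil.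
by move=> /andP[Pg Ps]; rewrite big_cons; apply: SD; [apply: Smon | apply: IHs].
Qed.

Lemma mon_span_sum P (I : Type) (s : seq I) (C : pred I) (F : I -> A) :
  (forall i : I, C i -> mon_span P (F i)) -> mon_span P (\sum_(i <- s | C i) F i).
Proof.
by move=> PF; apply: big_ind => //; [apply: mon_span0 | apply: mon_spanD].
Qed.

Lemma mon_spanZ P r f : mon_span P f -> mon_span P (iota r * f).
Proof.
move: f; apply: mon_span_ind => [|f g Pf Pg|s gamma Pg].
- by rewrite mulr0; apply: mon_span0.
- by rewrite mulrDr; apply: mon_spanD.
- by rewrite mulrA -rmorphM; apply: mon_span_mon.
Qed.

Lemma mon_spanN P f : mon_span P f -> mon_span P (- f).
Proof. by move=> /(mon_spanZ (-1)); rewrite rmorphN rmorph1 mulN1r. Qed.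

Lemma mon_spanW P Q f : subpred P Q -> mon_span P f -> mon_span Q f.
Proof.
move=> PQ; move: f; apply: mon_span_ind => [|f g|r gamma /PQ].
- exact: mon_span0.
- exact: mon_spanD.
- exact: mon_span_mon.
Qed.

Lemma collect_monomials (s : seq (exponent n * R)) :
  \sum_(p <- s) iota p.2 * mon x p.1 =
  \sum_(gamma <- undup (map fst s)) iota (\sum_(p <- s | p.1 == gamma) p.2) * mon x gamma.
Proof.
transitivity (\sum_(gamma <- undup (map fst s))
                \sum_(p <- s | p.1 == gamma) iota p.2 * mon x p.1); last first.
  apply: eq_bigr => gamma _; rewrite rmorph_sum mulr_suml.
  by apply: eq_bigr => p /eqP ->.
rewrite (exchange_big_dep predT)//=; apply: eq_big_seq => p s_p.
rewrite (eq_bigl (pred1 p.1)) => [|gamma]; last by rewrite /= eq_sym.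
rewrite -big_filter filter_pred1_uniq ?big_seq1 ?undup_uniq//.
by rewrite mem_undup map_f.
Qed.

Variables (sigma : 'I_n -> {rmorphism R -> R}) (delta : 'I_n -> {additive R -> R}).
Hypothesis pbwA : skew_PBW_extension iota x.
Hypothesis sysA : associated_system sigma delta iota x.
Hypothesis abR : Abelian_ring R.

Lemma mon_span_free P r gamma :
  ~~ P gamma -> mon_span P (iota r * mon x gamma) -> r = 0.
Proof.
move=> nPg [s Ps]; rewrite collect_monomials => /eqP.
set t := undup _; set c := fun beta => \sum_(p <- s | p.1 == beta) p.2.
have nt_g : gamma \notin t.
  apply: contra nPg; rewrite mem_undup => /mapP[p s_p ->].
  exact: (allP Ps).
pose c' beta := if beta == gamma then r else - c beta.
rewrite -subr_eq0 => /eqP sum0.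
have uniq_gt : uniq (gamma :: t) by rewrite /= nt_g undup_uniq.
suff sumc' : \sum_(beta <- gamma :: t) iota (c' beta) * mon x beta = 0.
  by have := pbw_free pbwA uniq_gt sumc' (mem_head _ _); rewrite /c' eqxx.
rewrite -[RHS]sum0 big_cons {1}/c' eqxx -sumrN.
congr (_ + _); apply: eq_big_seq => beta t_beta.
rewrite /c'; case: eqVneq => [eq_bg|_]; last by rewrite rmorphN mulNr.
by rewrite eq_bg (negPf nt_g) in t_beta.
Qed.

Lemma pbw_decomposition f : exists (s : seq (exponent n)) (c : exponent n -> R),
  uniq s /\ f = \sum_(gamma <- s) iota (c gamma) * mon x gamma.
Proof.
have [s [c ->]] := pbw_span pbwA f.
pose t := [seq (gamma, c gamma) | gamma <- s].
have -> : \sum_(gamma <- s) iota (c gamma) * mon x gamma =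
          \sum_(p <- t) iota p.2 * mon x p.1.
  by rewrite big_map.
by rewrite collect_monomials; do 2!eexists; split; [apply: undup_uniq | by []].
Qed.

(** The coefficients d_(i,j) are only assumed nonzero, but right invertibility
    is what lets them be cancelled on the right, and it is stable under products
    and under the sigma_i. *)
Definition right_invertible u := exists v, u * v = 1.

Lemma right_invertible1 : right_invertible 1.
Proof. by exists 1; rewrite mulr1. Qed.

Lemma right_invertibleM u v :
  right_invertible u -> right_invertible v -> right_invertible (u * v).
Proof.
move=> [u' uu'] [v' vv']; exists (v' * u').
by rewrite mulrA -(mulrA u) vv' mulr1.
Qed.

Lemma right_invertible_sigma u i : right_invertible u -> right_invertible (sigma i u).
Proof. by move=> [v uv]; exists (sigma i v); rewrite -rmorphM uv rmorph1. Qed.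

Definition low (k : nat) : pred (exponent n) := fun gamma => (degree gamma < k)%N.

Lemma lowW k l f : (k <= l)%N -> mon_span (low k) f -> mon_span (low l) f.
Proof. by move=> le_kl; apply: mon_spanW => gamma /leq_trans; apply. Qed.

Lemma low_linear r (t : 'I_n -> R) :
  mon_span (low 2) (iota r + \sum_k iota (t k) * x k).
Proof.
apply: mon_spanD.
  rewrite -[iota r]mulr1 -(mon0 x); apply: mon_span_mon.
  by rewrite /low /degree big1// => i _; apply: exp0.
apply: mon_span_sum => i _; rewrite -(mon_unit x i).
by apply: mon_span_mon; rewrite /low degree_unit.
Qed.

(** Rewriting x_j x_i through x_i x_j and back to x_j x_i, and comparing the
    coefficients in degree 2, gives d' d = 1.  Then d d' is an idempotent, hence
    central, so d d' = d d' d' d = d' (d d') d = 1. *)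
Lemma swap_variables i j : (j < i)%N -> exists d r (t : 'I_n -> R),
  right_invertible d /\
  x i * x j = iota d * (x j * x i) + (iota r + \sum_k iota (t k) * x k).
Proof.
move=> lt_ji.
have [d _ [r [t /eqP]]] := pbw_var pbwA j i.
rewrite subr_eq addrC -mulrA => /eqP xij.
have [d' _ [r' [t' /eqP]]] := pbw_var pbwA i j.
rewrite subr_eq addrC -mulrA => /eqP xji.
exists d, r, t; split=> //; exists d'.
have d'd : d' * d = 1.
  apply/esym/eqP; rewrite -subr_eq0; apply/eqP.
  apply: (@mon_span_free (low 2) _ (unit_exp i + unit_exp j)).
    by rewrite /low degreeD !degree_unit.
  have -> : mon x (unit_exp i + unit_exp j) = x j * x i.
    rewrite monS ?mon_unit// => k lt_kj; rewrite ffunE.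
    by case: eqVneq => // eq_ki; rewrite eq_ki ltnNge ltnW in lt_kj.
  rewrite rmorphB rmorph1 mulrBl mul1r {1}xji {1}xij mulrDr mulrA -rmorphM.
  rewrite addrC -addrA [X in _ + X]addrAC subrr add0r.
  apply: mon_spanD; first exact: low_linear.
  exact/mon_spanZ/low_linear.
have dd'_idem : idempotent_elt (d * d').
  by rewrite /idempotent_elt mulrA -(mulrA d) d'd mulr1.
have : d' * (d * d') * d = 1 by rewrite !mulrA d'd mul1r d'd.
by rewrite -(abR dd'_idem) -mulrA d'd mulr1.
Qed.

Definition near_mon f u gamma :=
  exists2 h, mon_span (low (degree gamma)) h & f = iota u * mon x gamma + h.

Lemma near_mon_low f u gamma k :
  near_mon f u gamma -> (degree gamma < k)%N -> mon_span (low k) f.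
Proof.
move=> [h low_h ->] lt_gk; apply: mon_spanD; first exact: mon_span_mon.
exact: lowW (ltnW lt_gk) low_h.
Qed.

(** This is separated from [variable_mul_mon] because the induction there needs
    it for all smaller degrees at once. *)
Lemma variable_mul_low_step k :
  (forall gamma, (degree gamma < k)%N -> forall i,
     exists2 u, right_invertible u & near_mon (x i * mon x gamma) u (gamma + unit_exp i)) ->
  forall i f, mon_span (low k) f -> mon_span (low k.+1) (x i * f).
Proof.
move=> nearP i; apply: mon_span_ind => [|f g low_f low_g|r gamma lt_gk].
- by rewrite mulr0; apply: mon_span0.
- by rewrite mulrDr; apply: mon_spanD.
rewrite mulrA (assoc_comm sysA) mulrDl -mulrA; apply: mon_spanD.
  have [u _ /near_mon_low near_u] := nearP gamma lt_gk i.
  by apply/mon_spanZ/near_u; rewrite degreeD degree_unit addn1.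
by apply: mon_span_mon; rewrite /low (ltn_trans lt_gk).
Qed.

(** Induction on the degree.  Write x^gamma = x_j x^gamma' with j the first index
    of the support.  If i <= j the product is already a standard monomial.
    Otherwise x_i is moved past x_j at the cost of a right invertible d and of
    terms of degree at most 1, the induction hypothesis applies to
    x_i x^gamma', and x_j is then put back in front, where it is in order. *)
Lemma variable_mul_mon gamma i : exists2 u,
  right_invertible u & near_mon (x i * mon x gamma) u (gamma + unit_exp i).
Proof.
have [k] := ubnP (degree gamma); elim: k gamma i => // k IHk gamma i.
have head_case j gamma' : supported_from j gamma' -> (i <= j)%N ->
    exists2 u, right_invertible u & near_mon (x i * mon x gamma') u (gamma' + unit_exp i).
  move=> sup_j le_ij; exists 1; first exact: right_invertible1.
  exists 0; first exact: mon_span0.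
  rewrite rmorph1 mul1r addr0 monS// => l lt_li.
  exact/sup_j/(leq_trans lt_li).
elim/exponent_ind: gamma => [|j gamma sup_j _].
  by move=> _; apply: (head_case i) => // l _; apply: exp0.
rewrite degreeD degree_unit addn1 ltnS => lt_gk.
case: (leqP i j) => [le_ij|lt_ji].
  by apply: (head_case j) => //; apply: supported_from_add.
have [d [r [t [inv_d xij]]]] := swap_variables lt_ji.
have [u inv_u [h low_h xi_gamma]] := IHk _ i lt_gk.
exists (d * sigma j u).
  exact/right_invertibleM/right_invertible_sigma.
exists (iota (d * delta j u) * mon x (gamma + unit_exp i) + iota d * (x j * h)
        + (iota r + \sum_k iota (t k) * x k) * mon x gamma).
  rewrite !degreeD !degree_unit !addn1.
  rewrite degreeD degree_unit addn1 in low_h.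
  apply: mon_spanD; first apply: mon_spanD.
  - by apply: mon_span_mon; rewrite /low degreeD degree_unit addn1.
  - apply/mon_spanZ/variable_mul_low_step => // gamma' lt_g' l.
    exact/IHk/(leq_trans lt_g').
  - rewrite mulrDl mulr_suml; apply: mon_spanD.
      by apply: mon_span_mon; rewrite /low.
    apply: mon_span_sum => l _; rewrite -mulrA; apply: mon_spanZ.
    have [v _ /near_mon_low] := IHk _ l lt_gk; apply.
    by rewrite degreeD degree_unit addn1.
rewrite monS// mulrA xij mulrDl addrA; congr (_ + _).
rewrite -!mulrA xi_gamma mulrDr (mulrA (x j)) (assoc_comm sysA) mulrDl -mulrA.
rewrite -monS; last exact: supported_from_add (ltnW lt_ji) sup_j.
by rewrite !mulrDr !rmorphM -!mulrA addrA [gamma + _ + _]addrAC.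
Qed.

Lemma variable_mul_low k i f : mon_span (low k) f -> mon_span (low k.+1) (x i * f).
Proof. by apply: variable_mul_low_step => gamma _ l; apply: variable_mul_mon. Qed.

(** Each variable of x^alpha contributes its sigma_i to the coefficient and a
    right invertible factor; the delta_i only produce terms of smaller degree. *)
Lemma mon_mul_term alpha r beta : exists2 u, right_invertible u &
  near_mon (mon x alpha * (iota r * mon x beta))
           (sigma_pow sigma alpha r * u) (alpha + beta).
Proof.
elim/exponent_ind: alpha => [|j alpha sup_j [u inv_u [h low_h IHa]]].
  exists 1; first exact: right_invertible1.
  exists 0; first exact: mon_span0.
  by rewrite /sigma_pow (comp_pow0 (fun i => sigma i)) mon0 mul1r mulr1 add0r addr0.
have [v inv_v [h' low_h' xj_mon]] := variable_mul_mon (alpha + beta) j.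
exists (sigma j u * v); first exact/right_invertibleM/inv_v/right_invertible_sigma.
rewrite /sigma_pow (comp_powS (fun i => sigma i))//= -/(sigma_pow sigma alpha r).
set s := sigma_pow sigma alpha r in IHa *.
exists (iota (sigma j (s * u)) * h' +
        iota (delta j (s * u)) * mon x (alpha + beta) + x j * h).
  rewrite addrAC degreeD degree_unit addn1; rewrite degreeD degree_unit addn1 in low_h'.
  apply: mon_spanD; last exact: variable_mul_low.
  by apply: mon_spanD; [apply: mon_spanZ | apply: mon_span_mon; rewrite /low].
rewrite monS// -mulrA IHa mulrDr mulrA (assoc_comm sysA) mulrDl -mulrA xj_mon mulrDr.
by rewrite [alpha + _ + _]addrAC mulrA -rmorphM [sigma j (s * u)]rmorphM !mulrA !addrA.
Qed.

Definition below gamma : pred (exponent n) := fun beta => deglex_lt beta gamma.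

Lemma mon_span_mul P Q gamma f g :
  (forall alpha beta, P alpha -> Q beta -> deglex_lt (alpha + beta) gamma) ->
  mon_span P f -> mon_span Q g -> mon_span (below gamma) (f * g).
Proof.
move=> PQ Pf Qg; move: f Pf; apply: mon_span_ind => [|f f'|r alpha Pa].
- by rewrite mul0r; apply: mon_span0.
- by rewrite mulrDl; apply: mon_spanD.
move: g Qg; apply: mon_span_ind => [|g g'|s beta Qb].
- by rewrite mulr0; apply: mon_span0.
- by rewrite mulrDr; apply: mon_spanD.
rewrite -mulrA; apply: mon_spanZ.
have [u _ [h low_h ->]] := mon_mul_term alpha s beta.
have lt_ab := PQ _ _ Pa Qb.
apply: mon_spanD; first exact: mon_span_mon.
apply: mon_spanW low_h => gamma' /deglex_degree lt_d.
exact: deglex_trans lt_d lt_ab.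
Qed.

(** The term in x^(alpha + beta) of the product comes from the two leading terms
    alone; its coefficient vanishes by freeness of the monomials, and its right
    invertible factor is cancelled. *)
Lemma leading_mul0 a b alpha beta f g :
  mon_span (below alpha) f -> mon_span (below beta) g ->
  (iota a * mon x alpha + f) * (iota b * mon x beta + g) = 0 ->
  a * sigma_pow sigma alpha b = 0.
Proof.
move=> low_f low_g fg0.
have [u [v uv] [h low_h mon_ab]] := mon_mul_term alpha b beta.
suff : a * (sigma_pow sigma alpha b * u) = 0.
  by move=> /(congr1 ( *%R^~ v)); rewrite mul0r -!mulrA uv mulr1.
apply: (@mon_span_free (below (alpha + beta)) _ (alpha + beta)).
  by rewrite /below deglex_irr.
rewrite mulrDl !mulrDr -mulrA mon_ab mulrDr !mulrA -rmorphM -!addrA in fg0.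
move/eqP: fg0; rewrite addr_eq0 mulrA => /eqP ->.
have one_term r gamma : mon_span (pred1 gamma) (iota r * mon x gamma).
  by apply: mon_span_mon => /=.
apply/mon_spanN/mon_spanD.
  apply: mon_spanZ; apply: mon_spanW low_h => gamma; exact: deglex_degree.
apply: mon_spanD; last apply: mon_spanD.
- apply: (mon_span_mul _ (one_term _ _) low_g) => alpha' beta' /eqP-> ; exact: deglex_addr.
- rewrite -mulrA; apply: (mon_span_mul _ low_f (one_term _ _)) => alpha' beta' + /eqP-> ;
  exact: deglex_addl.
- apply: (mon_span_mul _ low_f low_g) => alpha' beta' lt_a lt_b.
  by apply: deglex_trans (deglex_addl _ lt_a); apply: deglex_addr.
Qed.

End SkewPBWCalculus.

(** * The Armendariz property and reducedness of the extension *)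

Section BaerExtension.
Variables (R A : pzRingType) (n : nat) (iota : {rmorphism R -> A}) (x : 'I_n -> A).
Variables (sigma : 'I_n -> {rmorphism R -> R}) (delta : 'I_n -> {additive R -> R}).
Hypothesis n_gt0 : (0 < n)%N.
Hypothesis pbwA : skew_PBW_extension iota x.
Hypothesis sysA : associated_system sigma delta iota x.
Hypothesis semiR : Sigma_semicommutative sigma.
Hypothesis baerR : Baer R.

Let abR : Abelian_ring R := idempotent_central n_gt0 semiR.
Let sigma_inj := assoc_inj sysA.

(** An idempotent e of R commutes with R, and with x_i because sigma_i fixes it
    and delta_i kills it. *)
Lemma idempotent_central_ext e f : idempotent_elt e -> iota e * f = f * iota e.
Proof.
move=> ee; have [s [c [_ ->]]] := pbw_decomposition pbwA f.
rewrite mulr_sumr mulr_suml; apply: eq_bigr => gamma _.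
rewrite mulrA -rmorphM (abR ee) rmorphM -!mulrA; congr (_ * _).
elim/exponent_ind: gamma => [|j gamma sup_j IHg]; first by rewrite mon0 mulr1 mul1r.
rewrite monS// -mulrA -IHg !mulrA (assoc_comm sysA).
by rewrite (idempotent_sigma semiR _ ee)
           (idempotent_delta n_gt0 semiR (assoc_derivation sysA) _ ee) rmorph0 addr0.
Qed.

Lemma annihilated_coefficient a b f : a * b = 0 -> iota a * f * iota b = 0.
Proof.
have [e [ee ae0 anne]] := annihilator_idempotent baerR a => /anne ->.
by rewrite rmorphM mulrA -(mulrA (iota a)) -(idempotent_central_ext f ee) mulrA
           -rmorphM ae0 rmorph0 !mul0r.
Qed.

Lemma tail_below (I : eqType) (u : I -> exponent n) (a : I -> R) i0 (s : seq I) :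
  path (fun i j : I => deglex_lt (u j) (u i)) i0 s ->
  mon_span iota x (below (u i0)) (\sum_(i <- s) iota (a i) * mon x (u i)).
Proof.
move=> path_s; rewrite big_seq; apply: mon_span_sum => i s_i.
apply: mon_span_mon; apply: (allP (order_path_min _ path_s)) => //.
by move=> i1 i2 i3 lt12 lt23; apply: deglex_trans lt23 lt12.
Qed.

(** Induction on the number of terms of g.  Compare the leading coefficients to
    get a b = 0 for the first one, so that b = e b; then (1 - e) g has no
    terms but those of the tail of g, is still killed by f since 1 - e is central in A,
    and a (1 - e) = a. *)
Lemma leading_coef_annihilates (J : eqType) (v : J -> exponent n) (b : J -> R)
    (t : seq J) a alpha f :
  sorted (fun i j : J => deglex_lt (v j) (v i)) t ->
  mon_span iota x (below alpha) f ->
  (iota a * mon x alpha + f) * (\sum_(j <- t) iota (b j) * mon x (v j)) = 0 ->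
  forall j, j \in t -> a * b j = 0.
Proof.
move=> sorted_t low_f; elim: t b sorted_t => //= j0 t IHt b path_t.
rewrite big_cons => fg0.
have [e [ee ae0 anne]] := annihilator_idempotent baerR a.
have ab0 : a * b j0 = 0.
  apply/(mul_sigma_pow0 sigma_inj semiR baerR _ _ alpha).
  exact: (leading_mul0 pbwA sysA abR low_f (tail_below _ path_t) fg0).
have e1 : idempotent_elt (1 - e).
  by rewrite /idempotent_elt mulrBl mul1r mulrBr mulr1 ee subrr subr0.
have tail0 j : j \in t -> a * ((1 - e) * b j) = 0.
  apply: (IHt (fun j => (1 - e) * b j)); first exact: path_sorted path_t.
  have := congr1 ( *%R (iota (1 - e))) fg0.
  rewrite mulr0 mulrA idempotent_central_ext// -mulrA mulrDr mulrA -rmorphM.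
  rewrite mulrBl mul1r -(anne _ ab0) subrr rmorph0 mul0r add0r mulr_sumr => fg0'.
  rewrite -[RHS]fg0'; congr (_ * _); apply: eq_bigr => k _.
  by rewrite rmorphM mulrA.
move=> j; rewrite inE => /predU1P [->//|/tail0].
by rewrite mulrA mulrBr mulr1 ae0 subr0.
Qed.

(** Once the leading coefficient of f kills all coefficients of g, the leading
    term of f kills g and can be removed.  The families are indexed by arbitrary
    types so that the same statement covers sums over ordinals and sums over
    lists of exponents. *)
Lemma coefficients_annihilate (I J : eqType) (u : I -> exponent n) (a : I -> R)
    (v : J -> exponent n) (b : J -> R) (s : seq I) (t : seq J) :
  uniq (map u s) -> uniq (map v t) ->
  (\sum_(i <- s) iota (a i) * mon x (u i)) *
  (\sum_(j <- t) iota (b j) * mon x (v j)) = 0 ->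
  forall i j, i \in s -> j \in t -> a i * b j = 0.
Proof.
move=> /deglex_sort[s' eq_s sorted_s] /deglex_sort[t' eq_t sorted_t].
rewrite (perm_big _ eq_s) (perm_big _ eq_t)/= => fg0 i j.
rewrite (perm_mem eq_s) (perm_mem eq_t) => + t_j.
elim: s' sorted_s fg0 {eq_s} => //= i0 s' IHs path_s.
rewrite big_cons => fg0.
have ab0 := leading_coef_annihilates sorted_t (tail_below a path_s) fg0.
rewrite inE => /predU1P [->|]; first exact: ab0.
apply: IHs (path_sorted path_s) _; rewrite -[RHS]fg0 mulrDl.
suff -> : iota (a i0) * mon x (u i0) * (\sum_(k <- t') iota (b k) * mon x (v k)) = 0.
  by rewrite add0r.
rewrite mulr_sumr big_seq big1// => k t_k.
by rewrite mulrA annihilated_coefficient ?mul0r// ab0.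
Qed.

Lemma extension_Armendariz : Sigma_skew_Armendariz sigma iota x.
Proof.
move=> m t a u b v u_inj v_inj fg0 i j.
apply/(mul_sigma_pow0 sigma_inj semiR baerR).
have uniq_all k (w : 'I_k -> exponent n) : injective w -> uniq (map w (index_enum 'I_k)).
  by move=> w_inj; rewrite map_inj_uniq ?index_enum_uniq.
by apply: (coefficients_annihilate (uniq_all _ _ u_inj) (uniq_all _ _ v_inj) fg0);
  rewrite mem_index_enum.
Qed.

(** If f f = 0, each coefficient of f has square zero. *)
Lemma extension_reduced : reduced A.
Proof.
apply: sqr_free_reduced => f; have [s [c [uniq_s ->]]] := pbw_decomposition pbwA f.
have uniq_ids : uniq (map id s) by rewrite map_id.
move=> /(coefficients_annihilate uniq_ids uniq_ids) cc0.
rewrite big_seq big1// => gamma s_g.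
have redR := coefficient_reduced n_gt0 semiR baerR.
by rewrite (reduced_sqr0 redR (cc0 _ _ s_g s_g)) rmorph0 mul0r.
Qed.

End BaerExtension.

Theorem corollary4p7 (R A : pzRingType) (n : nat) (n_gt0 : (0 < n)%N)
  (iota : {rmorphism R -> A}) (x : 'I_n -> A)
  (sigma : 'I_n -> {rmorphism R -> R}) (delta : 'I_n -> {additive R -> R})
  (pbwA : skew_PBW_extension iota x)
  (sys : associated_system sigma delta iota x)
  (semiR : Sigma_semicommutative sigma)
  (baerR : Baer R) :
  Sigma_rigid sigma /\
  (reduced A /\ Abelian_ring A) /\
  Sigma_skew_Armendariz sigma iota x /\
  Sigma_Delta_compatible sigma delta /\
  (weak_symmetric R <-> weak_symmetric A) /\
  (reflexive_ring R /\ reflexive_ring A) /\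
  Sigma_skew_RNP sigma.
Proof.
have redR := coefficient_reduced n_gt0 semiR baerR.
have redA := extension_reduced n_gt0 pbwA sys semiR baerR.
split; first exact: coefficient_rigid (assoc_inj sys) n_gt0 semiR baerR.
split; first by split; [exact: redA | exact: reduced_Abelian redA].
split; first exact: (extension_Armendariz n_gt0 pbwA sys semiR baerR).
split.
  exact: coefficient_compatible (assoc_inj sys) n_gt0 semiR (assoc_derivation sys) baerR.
split.
  split=> _; [exact: (reduced_weak_symmetric redA)|].
  exact: (reduced_weak_symmetric redR).
split; first by split; [exact: (reduced_reflexive redR)|exact: (reduced_reflexive redA)].
move=> a b /redR -> /redR -> _ alpha.
by split=> r; rewrite ?sigma_pow0 ?mulr0 ?mul0r.
Qed.
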